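(* The folded component $\mathcal{F}$ (the graph specified in the context) satisfies $\mathrm{diam}(\mathcal{F})=\frac12(\mathrm{ord}(\ell)+1)$.
   Context: Let $p$ be a prime with $p\equiv 71$ or $119\pmod{120}$, let $\ell=2$, and let $\mathrm{ord}(\ell)$ be the order, in the ideal class group of $\mathbb{Q}(\sqrt{-p})$, of a prime ideal above $2$; it is an odd integer $\ge 3$. The folded component $\mathcal{F}$ (a component of the supersingular $2$-isogeny graph over $\mathbb{F}_p$ after identifying curves up to $\overline{\mathbb{F}_p}$-isomorphism, regarded as a simple undirected graph) is labelled so that $V(\mathcal{F})=\{0,1,\dots,\mathrm{ord}(\ell)-1\}$ and $$E(\mathcal{F})=\{\{2k-1,2k+1\}: 1\le k\le \tfrac12(\mathrm{ord}(\ell)-3)\}\cup\{\{2k+1,2k+2\}:0\le k\le \tfrac12(\mathrm{ord}(\ell)-3)\}\cup\{\{0,1\}\}.$$ The diameter is the maximum graph distance between two vertices. *)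

(* Defs.v *)
From HB Require Import structures.
From mathcomp Require Import all_boot all_order all_algebra all_field ring.
Set Implicit Arguments.
Unset Strict Implicit.
Unset Printing Implicit Defensive.
Import Order.TTheory GRing.Theory Num.Theory.
Local Open Scope ring_scope.

(* The field Q(sqrt(-p)) inside the algebraic numbers, as the Q-span of      *)
(* 1 and sqrt(-p), and its ring of integers.                                 *)
Definition quad_field (p : nat) : {pred algC} :=
  Crat_span [:: 1; sqrtC (- p%:R)].

Definition quad_int (p : nat) : {pred algC} :=
  [pred x | (x \in quad_field p) && (x \in Aint)].

Lemma quad_fieldP p x :
  reflect (exists a b, x = ratr a + ratr b * sqrtC (- p%:R))
          (x \in quad_field p).
Proof.
apply: (iffP (Crat_spanP _ _)) => [[a ->]|[a [b ->]]].
  exists (a ord0), (a ord_max).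
  by rewrite big_ord_recl big_ord1 /= mulr1; congr (_ + ratr (a _) * _); apply/val_inj.
exists [ffun i => if i == ord0 then a else b].
by rewrite big_ord_recl big_ord1 !ffunE /= mulr1.
Qed.

Lemma quad_int_subring p : subring_closed (quad_int p).
Proof.
split=> [|x y|x y]; rewrite !inE.
- rewrite rpred1 andbT; apply/quad_fieldP.
  by exists 1, 0; rewrite rmorph1 rmorph0 mul0r addr0.
- by move=> /andP[Kx Ax] /andP[Ky Ay]; rewrite !rpredB.
move=> /andP[/quad_fieldP[a [b Dx]] Ax] /andP[/quad_fieldP[c [d Dy]] Ay].
rewrite rpredM // andbT; apply/quad_fieldP.
exists (a * c - p%:R * (b * d)), (a * d + b * c).
rewrite Dx Dy !(rmorphB, rmorphD, rmorphM, rmorph_nat) /=.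
have Dp : sqrtC (- p%:R) * sqrtC (- p%:R) = - p%:R :> algC.
  by rewrite -expr2 sqrtCK.
by ring: Dp.
Qed.

HB.instance Definition _ p :=
  GRing.isSubringClosed.Build algC (quad_int p) (quad_int_subring p).

Record quad_ring (p : nat) :=
  QuadRing { quad_val :> algC; quad_valP : quad_val \in quad_int p }.

HB.instance Definition _ p := [isSub for @quad_val p].
HB.instance Definition _ p := [Choice of quad_ring p by <:].
HB.instance Definition _ p :=
  [SubChoice_isSubComNzRing of quad_ring p by <:].

Section IdealClasses.
Variable R : comNzRingType.

(* The ideal I ^ n, generated by the products of n elements of I; it is the  *)
(* unit ideal for n = 0.                                                     *)
Definition ideal_exp (I : {pred R}) (n : nat) (x : R) : Prop :=
  exists (m : nat) (c : 'I_m -> R) (a : 'I_m -> 'I_n -> R),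
    (forall i j, a i j \in I) /\ x = \sum_(i < m) c i * \prod_(j < n) a i j.

(* Two nonzero ideals I and J of a domain have the same ideal class when     *)
(* a I = b J for some nonzero a and b.                                       *)
Definition same_ideal_class (I J : R -> Prop) : Prop :=
  exists a b : R, [/\ a != 0, b != 0 &
    forall z, (exists2 x, I x & z = a * x) <-> (exists2 y, J y & z = b * y)].

(* n is the order of the class of I in the ideal class group, whose identity *)
(* is the class of the unit ideal.                                           *)
Definition is_class_order (I : {pred R}) (n : nat) : Prop :=
  let trivial_class k := same_ideal_class (ideal_exp I k) (fun=> True) in
  [/\ (0 < n)%N, trivial_class n
    & forall k, (0 < k)%N -> trivial_class k -> (n <= k)%N].

End IdealClasses.

Section GraphDistance.
Variables (V : finType) (e : rel V).

(* A shortest path has fewer than #|V| edges, so the search range loses      *)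
(* nothing; the value is #|V| when no path joins x to y.                     *)
Definition graph_dist (x y : V) : nat :=
  find (fun k => [exists t : k.-tuple V, path e x t && (last x t == y)])
       (iota 0 #|V|).

Definition diameter : nat := \max_(x : V) \max_(y : V) graph_dist x y.

End GraphDistance.

(* The bounds k <= (n - 3) / 2 are written without division, as              *)
(* 2 k + 3 <= n; they force k < n, so k may range over 'I_n.                 *)
Definition folded_edge (n : nat) (e : nat * nat) : bool :=
  [|| [exists k : 'I_n, [&& 1 <= k, 2 * k + 3 <= n &
                            e == (2 * k - 1, 2 * k + 1)]],
      [exists k : 'I_n, (2 * k + 3 <= n) && (e == (2 * k + 1, 2 * k + 2))]
    | e == (0, 1)]%N.

Definition folded_graph (n : nat) : rel 'I_n :=
  fun i j => folded_edge n (val i, val j) || folded_edge n (val j, val i).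

(* Main.v *)
Require Import Defs.
From mathcomp Require Import all_boot all_order all_algebra all_field.
From mathcomp Require Import zify ring.
Set Implicit Arguments.
Unset Strict Implicit.
Unset Printing Implicit Defensive.

(* The folded graph on 2 h + 3 vertices is a path 1, 3, ..., 2 h + 1 with one  *)
(* leaf 2 i + 2 on each 2 i + 1 and one more leaf 0 on 1. The height           *)
(* v / 2 + (v > 0), which is the distance from 0, is 1-Lipschitz and reaches   *)
(* h + 2 at the last leaf, while two leaves are always at most h + 2 apart.    *)
(*                                                                             *)
(* It remains to see that the order n of the class of P is odd and not 1.      *)
(* As p = 7 mod 8, a root t of an equation t^2 - t + 2 c = 0 lies in P, and    *)
(* P^k consists of the z such that z t'^k is divisible by 2^k, with t' = 1 - t *)
(* the conjugate of t. A generator a = (X + Y sqrt(-p)) / 2 of P^n then has    *)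
(* norm 2^n, i.e. X^2 + p Y^2 = 2^(n+2), and X is odd. This excludes n = 1,    *)
(* since p > 8. If n = 2 m, then (2^(m+1) - X) (2^(m+1) + X) = p Y^2 with      *)
(* coprime factors, so one is a square and the other p times a square. Hence a *)
(* is plus or minus a square b^2, and b generates P^m, against the minimality  *)
(* of n.                                                                       *)

(** The graph half, [diameter_folded_graph], works for every odd order at least 3; the arithmetic
    half, [class_order_above_two], shows that the order has this shape. The arithmetic half needs no
    factorisation of ideals. Since [t] and its conjugate sum to 1, so are their powers comaximal,
    and membership in the [k]-th power of [P] becomes a single integrality condition
    ([mem_ideal_exp]). The class of that power is trivial exactly when it has a generator
    ([principal_ideal_exp]); a generator has norm [2 ^ k] ([generator_norm]) and, for positive [k],
    odd trace ([generator_trace_odd]). For an even exponent, [norm_form_even_power] extracts a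
    square root of the generator up to sign, and the root generates the half power
    ([generator_sqrt]), so a least exponent cannot be even. Exponent 1 is excluded by size in
    [no_generator_one]. *)

Section GraphDistance.

(** * Walks and graph distance *)

Variables (V : finType) (e : rel V).

Definition walk (k : nat) (x y : V) : Prop :=
  exists s : seq V, [/\ path e x s, last x s = y & size s = k].

Lemma walk0 x : walk 0 x x.
Proof. by exists [::]. Qed.

Lemma walk1 x y : e x y -> walk 1 x y.
Proof. by move=> exy; exists [:: y]; rewrite /= exy. Qed.

Lemma walk_trans y j k x z : walk j x y -> walk k y z -> walk (j + k) x z.
Proof.
move=> [s [xs <- <-]] [t [yt <- <-]]; exists (s ++ t).
by rewrite cat_path xs yt last_cat size_cat.
Qed.

Lemma walk_sym k x y : symmetric e -> walk k x y -> walk k y x.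
Proof.
move=> e_sym [s [xs <- <-]]; exists (rev (belast x s)); split.
- by rewrite rev_path; under eq_path => u v do rewrite e_sym.
- by case: s {xs} => //= u s; rewrite rev_cons last_rcons.
by rewrite size_rev size_belast.
Qed.

Lemma graph_dist_le k x y : walk k x y -> graph_dist e x y <= k.
Proof.
move=> [s [xs last_s size_s]]; rewrite /graph_dist; set a := (X in find X _).
have ak : a k.
  apply/existsP; have sizek : size s == k by apply/eqP.
  by exists (Tuple sizek); rewrite /= xs last_s eqxx.
(* A walk longer than the search range is no obstacle: [find] never exceeds the size of the
   range. *)
have [k_lt | k_ge] := ltnP k #|V|; last first.
  by apply: leq_trans (find_size _ _) _; rewrite size_iota.
rewrite leqNgt; apply/negP => /(before_find 0).
by rewrite nth_iota // add0n ak.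
Qed.

(** The second alternative is the value of a failed search. *)
Lemma graph_distP x y :
  walk (graph_dist e x y) x y \/ graph_dist e x y = #|V|.
Proof.
rewrite /graph_dist; set a := (X in find X _).
have [has_a | hasN_a] := boolP (has a (iota 0 #|V|)); last first.
  by right; rewrite hasNfind // size_iota.
left; have := nth_find 0 has_a; rewrite nth_iota ?add0n; last first.
  by rewrite -[ltnRHS](size_iota 0) -has_find.
by case/existsP => t /andP[xt /eqP last_t]; exists t; rewrite size_tuple.
Qed.

Lemma walk_lipschitz (f : V -> nat) k x y :
  (forall u v, e u v -> f v <= (f u).+1) -> walk k x y -> f y <= f x + k.
Proof.
move=> f_lip [s [xs <- <-]]; elim: s x xs => [|u s IHs] x /=.
  by rewrite addn0.
by case/andP => /f_lip fu /IHs /leq_trans; apply; rewrite addnS -addSn leq_add2r.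
Qed.

End GraphDistance.

(** * The diameter of the folded graph *)

Section FoldedGraph.
Variable n : nat.

Lemma folded_edgeP a b :
  reflect [\/ exists2 k, (1 <= k) && (2 * k + 3 <= n) &
                a = 2 * k - 1 /\ b = 2 * k + 1,
              exists2 k, 2 * k + 3 <= n & a = 2 * k + 1 /\ b = 2 * k + 2
            | a = 0 /\ b = 1]
          (folded_edge n (a, b)).
Proof.
apply: (iffP or3P) => -[].
- case/existsP => k /and3P[k1 kn /eqP[-> ->]]; constructor 1.
  by exists k => //; rewrite k1.
- case/existsP => k /andP[kn /eqP[-> ->]]; constructor 2.
  by exists k.
- by move/eqP => [-> ->]; constructor 3.
- case=> k /andP[k1 kn] [-> ->]; constructor 1; apply/existsP.
  have lt_kn : k < n by lia.
  by exists (Ordinal lt_kn); rewrite /= k1 kn eqxx.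
- case=> k kn [-> ->]; constructor 2; apply/existsP.
  have lt_kn : k < n by lia.
  by exists (Ordinal lt_kn); rewrite /= kn eqxx.
by case=> -> ->; constructor 3.
Qed.

Lemma folded_graph_sym : symmetric (@folded_graph n).
Proof. by move=> i j; rewrite /folded_graph orbC. Qed.

Let e := @folded_graph n.

Lemma folded_walk_spine h i j (x y : 'I_n) :
  n = 2 * h + 3 -> x = 2 * i + 1 :> nat -> y = 2 * (i + j) + 1 :> nat ->
  walk e j x y.
Proof.
move=> nE xE; elim: j y => [|j IHj] y yE.
  have -> : y = x by apply: val_inj; rewrite /= xE yE addn0.
  exact: walk0.
have y'n : 2 * (i + j) + 1 < n by have := ltn_ord y; lia.
rewrite -addn1; apply: (@walk_trans _ _ (Ordinal y'n)); first exact: IHj.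
apply/walk1/orP; left; apply/folded_edgeP; constructor 1.
by exists (i + j.+1); have := ltn_ord y; rewrite /= ?yE; lia.
Qed.

(* Every vertex is a spine vertex 2 i + 1 or hangs from one. *)
Lemma folded_walk_to_spine h (x : 'I_n) :
  n = 2 * h + 3 ->
  exists i (y : 'I_n) k,
    [/\ y = 2 * i + 1 :> nat, i <= h, k <= 1 & walk e k x y].
Proof.
move=> nE; have [x0 | x_gt0] := posnP x.
  have n1 : 1 < n by lia.
  exists 0, (Ordinal n1), 1; split=> //.
  by apply/walk1/orP; left; apply/folded_edgeP; constructor 3.
have [odd_x | even_x] := boolP (odd x).
  exists x./2, x, 0; split; [lia | | by [] | exact: walk0].
  by have := ltn_ord x; lia.
have yn : x.-1 < n by have := ltn_ord x; lia.
exists x.-1./2, (Ordinal yn), 1; split=> //=; first by lia.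
  by have := ltn_ord x; lia.
apply/walk1/orP; right; apply/folded_edgeP; constructor 2.
by exists x.-1./2; have := ltn_ord x; rewrite /=; lia.
Qed.

(** At most one edge leads from each end to the spine, and the spine has [h] edges. *)
Lemma folded_dist_le h (x y : 'I_n) :
  n = 2 * h + 3 -> graph_dist e x y <= h + 2.
Proof.
move=> nE; have e_sym := folded_graph_sym.
have [i [u [k [uE ih k1 xu]]]] := folded_walk_to_spine x nE.
have [j [v [l [vE jh l1 yv]]]] := folded_walk_to_spine y nE.
have [d uv dE] : exists2 d, walk e d u v & d <= h.
  have [ij | /ltnW ji] := leqP i j.
    exists (j - i); last by lia.
    by apply: folded_walk_spine nE uE _; rewrite subnKC.
  exists (i - j); last by lia.
  apply: walk_sym => //.
  by apply: folded_walk_spine nE vE _; rewrite subnKC.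
have /graph_dist_le/leq_trans := walk_trans (walk_trans xu uv) (walk_sym e_sym yv).
by apply; lia.
Qed.

Lemma folded_height_lipschitz (u v : 'I_n) :
  e u v -> v./2 + (0 < v) <= (u./2 + (0 < u)).+1.
Proof. by case/orP => /folded_edgeP[[k H [-> ->]]|[k H [-> ->]]|[-> ->]]; lia. Qed.

Lemma diameter_folded_graph h : n = 2 * h + 3 -> diameter e = h + 2.
Proof.
move=> nE; apply/eqP; rewrite eqn_leq; apply/andP; split.
  apply/bigmax_leqP => x _; apply/bigmax_leqP => y _.
  exact: folded_dist_le.
have n0 : 0 < n by lia.
have nmax : 2 * h + 2 < n by lia.
pose x := Ordinal n0; pose y := Ordinal nmax.
apply: leq_trans (leq_bigmax x); apply: leq_trans (leq_bigmax y).
(* The extremal pair is 0 and the last leaf, of heights 0 and [h + 2]. The default value [2 * h + 3]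
   would also satisfy the bound, so connectedness need not be invoked. *)
have [xy | ->] := graph_distP e x y; last by rewrite card_ord; lia.
by have := walk_lipschitz folded_height_lipschitz xy; rewrite /=; lia.
Qed.

End FoldedGraph.

(** * Coprime factors of a square or of a prime times a square *)

Lemma gcdn_sqr u y : gcdn (u ^ 2) (y ^ 2) = gcdn u y ^ 2.
Proof.
have [->|u_gt0] := posnP u; first by rewrite exp0n // !gcd0n.
have g_gt0 : 0 < gcdn u y by rewrite gcdn_gt0 u_gt0.
have /divnK uE := dvdn_gcdl u y; have /divnK yE := dvdn_gcdr u y.
have co : coprime (u %/ gcdn u y) (y %/ gcdn u y).
  by rewrite /coprime -(eqn_pmul2r g_gt0) muln_gcdl uE yE mul1n.
rewrite -[in LHS]uE -[X in gcdn _ (X ^ 2)]yE !expnMn -muln_gcdl.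
by rewrite (eqP (coprimeXl 2 (coprimeXr 2 co))) mul1n.
Qed.

(** The root is [gcdn u y]: its square is the gcd of [u * u] and [u * v], which is [u] by
    coprimality. *)
Lemma coprime_mul_sqr u v y :
  coprime u v -> u * v = y ^ 2 -> exists2 s, u = s ^ 2 & s %| y.
Proof.
move=> co_uv uvE; exists (gcdn u y); last exact: dvdn_gcdr.
by rewrite -gcdn_sqr -uvE expnS expn1 -muln_gcdr (eqP co_uv) muln1.
Qed.

Lemma coprime_mul_prime_sqr p u v y : prime p -> p %| u ->
  coprime u v -> u * v = p * y ^ 2 ->
  exists s t, [/\ u = p * s ^ 2, v = t ^ 2 & s * t = y].
Proof.
move=> p_prime /dvdnP[a ->] co_uv; rewrite [a * p]mulnC -mulnA => /eqP.
rewrite eqn_pmul2l ?prime_gt0 // => /eqP uvE.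
have co_av : coprime a v by apply: coprime_dvdl co_uv; apply: dvdn_mulr.
have [s sE _] := coprime_mul_sqr co_av uvE.
have [t tE _] : exists2 t, v = t ^ 2 & t %| y.
  by apply: (@coprime_mul_sqr _ a); rewrite 1?coprime_sym 1?mulnC.
exists s, t; split; [by rewrite sE mulnC | by [] |].
by apply/eqP; rewrite -(eqn_exp2r _ _ (isT : 0 < 2)) expnMn -sE -tE uvE.
Qed.

(* The factors of [(2 ^ m.+1 - x) * (2 ^ m.+1 + x) = p * y ^ 2] are coprime. *)
Lemma norm_form_even_power p m x y : prime p -> odd x -> 0 < y ->
    x ^ 2 + p * y ^ 2 = 2 ^ m.+1.*2 ->
  exists s t, [/\ t ^ 2 + p * s ^ 2 = 2 ^ m.+2, s * t = y
    & t ^ 2 = p * s ^ 2 + 2 * x \/ p * s ^ 2 = t ^ 2 + 2 * x].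
Proof.
move=> p_prime odd_x y_gt0 normE.
pose q := 2 ^ m.+1; have qE : 2 ^ m.+1.*2 = q ^ 2 by rewrite -expnM muln2.
have q2E : 2 ^ m.+2 = 2 * q by rewrite expnS.
have p_gt0 := prime_gt0 p_prime.
have x_lt : x < q.
  rewrite -(ltn_exp2r _ _ (isT : 0 < 2)) -qE -normE -addn1 leq_add2l.
  by rewrite muln_gt0 p_gt0 expn_gt0 y_gt0.
have mulE : (q - x) * (q + x) = p * y ^ 2.
  by rewrite -subn_sqr -qE -normE addKn.
(* The gcd is that of [q - x] and [2 * x]; here [q - x] is odd, and a common divisor with [x] would
   divide the power of two [q] while [x] is odd. *)
have co : coprime (q - x) (q + x).
  rewrite (_ : q + x = (q - x) + 2 * x) /coprime ?gcdnDl; last by lia.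
  rewrite -/(coprime _ _) coprimeMr coprimen2; apply/andP; split.
    by rewrite oddB 1?ltnW // odd_x oddX.
  rewrite coprime_sym /coprime -gcdnDl subnKC 1?ltnW // -/(coprime _ _).
  by rewrite coprimeXr // coprimen2.
have: p %| (q - x) * (q + x) by rewrite mulE dvdn_mulr.
(* The factor divisible by [p] is [p * s ^ 2] and the other is [t ^ 2]. Their sum is [2 * q], and
   their difference is [2 * x] up to sign. *)
rewrite Euclid_dvdM // => /orP[p_dvd | p_dvd].
  have [s [t [sE tE stE]]] := coprime_mul_prime_sqr p_prime p_dvd co mulE.
  by exists s, t; rewrite q2E -sE -tE; split; [lia | | left; lia].
move: co mulE; rewrite coprime_sym mulnC => co mulE.
have [s [t [sE tE stE]]] := coprime_mul_prime_sqr p_prime p_dvd co mulE.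
by exists s, t; rewrite q2E -sE -tE; split; [lia | | right; lia].
Qed.

Import Order.TTheory GRing.Theory Num.Theory.
Local Open Scope ring_scope.

(** * Conjugation, trace, norm and integers of the quadratic field *)

Section QuadraticIntegers.
Variable p : nat.
Let w : algC := sqrtC (- p%:R).
Let S := quad_int p.

Lemma sqr_quad_root : w ^+ 2 = - p%:R.
Proof. exact: sqrtCK. Qed.

Lemma conj_quad_root : w^* = - w.
Proof.
have normE : w * w^* = p%:R.
  have: `|w| ^+ 2 = p%:R.
    by rewrite -normrX sqr_quad_root normrN normr_nat.
  by rewrite normCK.
have [w0 | w_neq0] := eqVneq w 0; first by rewrite w0 conjC0 oppr0.
by apply: (mulfI w_neq0); rewrite normE mulrN -expr2 sqr_quad_root opprK.
Qed.

Lemma conj_quad a b : (ratr a + ratr b * w)^* = ratr a - ratr b * w.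
Proof.
have conjD x y : (x + y)^* = x^* + y^* :> algC := rmorphD _ x y.
have conjM x y : (x * y)^* = x^* * y^* :> algC := rmorphM _ x y.
have conj_ratr c : (ratr c : algC)^* = ratr c by exact/conj_Crat/Crat_rat.
by rewrite conjD (conjM (ratr b)) !conj_ratr conj_quad_root mulrN.
Qed.

Lemma conj_quad_field z : z \in quad_field p -> z^* \in quad_field p.
Proof.
move=> /quad_fieldP[a [b ->]]; apply/quad_fieldP; exists a, (- b).
by rewrite conj_quad raddfN mulNr.
Qed.

Lemma quad_fieldM x y :
  x \in quad_field p -> y \in quad_field p -> x * y \in quad_field p.
Proof.
move=> /quad_fieldP[a [b ->]] /quad_fieldP[c [d ->]]; apply/quad_fieldP.
exists (a * c - p%:R * (b * d)), (a * d + b * c).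
rewrite !(rmorphB, rmorphD, rmorphM, rmorph_nat) /= -/w.
by have := sqr_quad_root; rewrite expr2 => Dw; ring: Dw.
Qed.

Lemma quad_field_rat a : ratr a \in quad_field p.
Proof. by apply/quad_fieldP; exists a, 0; rewrite rmorph0 mul0r addr0. Qed.

Lemma quad_trace_Crat z : z \in quad_field p -> z + z^* \in Crat.
Proof.
move=> /quad_fieldP[a [b ->]]; apply/CratP; exists (a + a).
by rewrite conj_quad [RHS]rmorphD addrACA subrr addr0.
Qed.

Lemma quad_norm_Crat z : z \in quad_field p -> z * z^* \in Crat.
Proof.
move=> /quad_fieldP[a [b ->]]; apply/CratP; exists (a ^+ 2 + p%:R * b ^+ 2).
rewrite conj_quad mulrC -subr_sqr -/w [(_ * w) ^+ 2]exprMn sqr_quad_root mulrN opprK.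
by rewrite [RHS]rmorphD rmorphM rmorph_nat !rmorphXn [_ * p%:R]mulrC.
Qed.

Lemma quad_fieldV z : z \in quad_field p -> z^-1 \in quad_field p.
Proof.
move=> Kz; rewrite invC_norm normCK; apply: quad_fieldM; last exact: conj_quad_field.
by have /rpredVr/CratP[a ->] := quad_norm_Crat Kz; apply: quad_field_rat.
Qed.

Lemma quad_field_div x y :
  x \in quad_field p -> y \in quad_field p -> x / y \in quad_field p.
Proof. by move=> Kx Ky; apply/quad_fieldM/quad_fieldV. Qed.

Lemma Aint_conj z : z \in Aint -> z^* \in Aint.
Proof. by rewrite Aint_aut. Qed.

Lemma quad_int_field z : z \in S -> z \in quad_field p.
Proof. by case/andP. Qed.

Lemma quad_int_Aint z : z \in S -> z \in Aint.
Proof. by case/andP. Qed.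

Lemma quad_intE z : z \in quad_field p -> z \in Aint -> z \in S.
Proof. by rewrite inE => -> ->. Qed.

Lemma conj_quad_int z : z \in S -> z^* \in S.
Proof.
by case/andP=> Kz Az; rewrite quad_intE ?conj_quad_field ?Aint_conj.
Qed.

Lemma quad_trace_int z : z \in S -> z + z^* \in Num.int.
Proof.
move=> Sz; rewrite Cint_rat_Aint ?quad_trace_Crat ?quad_int_field //.
by rewrite rpredD ?quad_int_Aint ?conj_quad_int.
Qed.

Lemma quad_norm_int z : z \in S -> z * z^* \in Num.int.
Proof.
move=> Sz; rewrite Cint_rat_Aint ?quad_norm_Crat ?quad_int_field //.
by rewrite rpredM ?quad_int_Aint ?conj_quad_int.
Qed.

Lemma Aint_quadratic (x y : algC) :
  x + y \in Num.int -> x * y \in Num.int -> x \in Aint.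
Proof.
move=> /intrP[t tE] /intrP[m mE].
apply: (@root_monic_Aint (('X - x%:P) * ('X - y%:P))).
- by rewrite rootE hornerM !hornerE subrr mul0r.
- by rewrite monicMl monicXsubC.
have -> : ('X - x%:P) * ('X - y%:P) = 'X^2 - (x + y)%:P * 'X + (x * y)%:P.
  by rewrite rmorphD rmorphM /=; ring.
apply/polyOverP => i; rewrite tE mE coefD coefB coefXn coefCM coefX coefC.
rewrite rpredD ?rpredB ?rpredM ?rpred_nat ?intr_int //.
by case: ifP => _; rewrite ?intr_int ?rpred0.
Qed.

(** Substituting ['X^2] in the minimal polynomial of [x ^+ 2] gives a monic integral polynomial
    vanishing at [x]. *)
Lemma Aint_sqr (x : algC) : x ^+ 2 \in Aint -> x \in Aint.
Proof.
move=> Ax2; have [q [qE q_monic] _] := minCpolyP (x ^+ 2).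
have q_int : minCpoly (x ^+ 2) \is a polyOver Num.int by [].
apply: (@root_monic_Aint (minCpoly (x ^+ 2) \Po 'X^2)).
- by rewrite /root horner_comp hornerXn; apply: root_minCpoly.
- rewrite monicE lead_coef_comp ?size_polyXn // lead_coefXn expr1n mulr1.
  by rewrite -monicE minCpoly_monic.
by rewrite polyOver_comp // rpredX ?polyOverX.
Qed.

Lemma Crat_sqr_int x : x \in Crat -> x ^+ 2 \in Num.int -> x \in Num.int.
Proof. by move=> Qx Zx2; apply/Cint_rat_Aint/Aint_sqr/Aint_Cint. Qed.

Lemma quad_int_coords z : prime p -> z \in S ->
  exists X Y : int, 2%:R * z = X%:~R + Y%:~R * w.
Proof.
move=> p_prime Sz; have [A [B [QB zE zcE]]] : exists A B : algC,
    [/\ B \in Crat, z = A + B * w & z^* = A - B * w].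
  have /quad_fieldP[a [b ->]] := quad_int_field Sz.
  by exists (ratr a), (ratr b); rewrite Crat_rat conj_quad.
have p_neq0 : p%:R != 0 :> algC by rewrite pnatr_eq0 -lt0n prime_gt0.
have /intrP[X XE] := quad_trace_int Sz.
have /intrP[M ME] := quad_norm_int Sz.
move: XE ME; rewrite zcE zE => XE.
have aE : 2%:R * A = X%:~R by rewrite -XE; ring.
have -> : (A + B * w) * (A - B * w) = A ^+ 2 - B ^+ 2 * w ^+ 2 by ring.
rewrite sqr_quad_root => ME.
(* The factor [p] turns the norm equation into an integral value of [W ^+ 2], so the rational [W] is
   an integer. As [p] divides its square it divides [W], hence [2 * B] is itself an integer. *)
pose W := p%:R * (2%:R * B).
have W2E : W ^+ 2 = (p%:Z * (4 * M - X ^+ 2))%:~R.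
  by rewrite rmorphM rmorphB rmorphM rmorphXn /= -ME -aE /W; ring.
have /intrP[V VE] : W \in Num.int.
  apply: Crat_sqr_int; last by rewrite W2E intr_int.
  by rewrite !rpredM ?rpred_nat.
have {W2E} VV : V ^+ 2 = p%:Z * (4 * M - X ^+ 2).
  by apply: (@intr_inj algC); rewrite -W2E VE rmorphXn.
have /dvdzP[Y YE] : (p %| V)%Z.
  rewrite dvdzE /=.
  have: (p %| `|V| ^ 2)%N by rewrite -abszX VV abszM dvdn_mulr.
  by rewrite Euclid_dvdX // => /andP[].
exists X, Y.
rewrite mulrDr aE mulrA; congr (_ + _ * _); apply: (mulfI p_neq0).
by rewrite -/W VE YE rmorphM mulrC.
Qed.

End QuadraticIntegers.

(** [1 - c ^+ k] is a multiple of [1 - c]. This is used with [c = a], giving [a ^+ k + q * b = 1],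
    and then with [c = q * b]. *)
Lemma bezout_exp (R : comNzRingType) (a b : R) k :
  a + b = 1 -> exists u v, u * a ^+ k + v * b ^+ k = 1.
Proof.
move=> ab1.
have bezout_expl (c d : R) : c + d = 1 -> exists q, c ^+ k + q * d = 1.
  move=> cd1; exists (\sum_(i < k) c ^+ i).
  have -> : d = - (c - 1) by rewrite -cd1; ring.
  by rewrite mulrN mulrC -subrX1; ring.
have [q qE] := bezout_expl a b ab1.
have [r rE] := bezout_expl (q * b) (a ^+ k) (etrans (addrC _ _) qE).
by exists r, (q ^+ k); rewrite -exprMn addrC.
Qed.

Lemma ideal_exp_lincomb (R : comNzRingType) (I : {pred R}) k (x y u v : R) :
  x \in I -> y \in I -> ideal_exp I k (u * x ^+ k + v * y ^+ k).
Proof.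
move=> Ix Iy; exists 2%N, (fun i => if i == ord0 then u else v).
exists (fun i _ => if i == ord0 then x else y); split=> [i j|]; first by case: ifP.
by rewrite big_ord_recl big_ord1 /= !prodr_const card_ord.
Qed.

(** * The prime ideal above 2 and its element of trace 1 *)

Section PrimeAboveTwo.
Variables (p : nat) (P : prime_idealr (quad_ring p)).
Hypothesis P_above_2 : 2%:R \in (P : pred (quad_ring p)).
Let w : algC := sqrtC (- p%:R).
Let S := quad_int p.
Let mem_P (r : quad_ring p) := r \in (P : pred (quad_ring p)).

Definition quad_conj (r : quad_ring p) : quad_ring p :=
  QuadRing (conj_quad_int (quad_valP r)).

Lemma quad_val_nat n : quad_val (n%:R : quad_ring p) = n%:R.
Proof. exact: (rmorph_nat (\val : quad_ring p -> algC)). Qed.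

Lemma quad_val_int k : quad_val (k%:~R : quad_ring p) = k%:~R.
Proof. exact: (rmorph_int (\val : quad_ring p -> algC)). Qed.

Lemma mem_prime_nat n : mem_P n%:R -> ~~ odd n.
Proof.
apply: contraL => odd_n; apply/negP => Pn.
have: mem_P 1; last by rewrite /mem_P idealr1.
have -> : 1 = n%:R - n./2%:R * 2%:R :> quad_ring p.
  by rewrite -natrM muln2 -{1}[n]odd_double_half odd_n natrD addrK.
by rewrite /mem_P rpredB // idealMr.
Qed.

Lemma mem_prime_int k : mem_P k%:~R -> exists j : int, k = 2 * j.
Proof.
move=> Pk; have Pabs : mem_P (`|k|%N)%:R.
  rewrite -[_%:R]/((`|k|%N)%:Z%:~R) abszE.
  by case: (ger0P k) => // _; rewrite rmorphN /mem_P rpredN.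
have /mem_prime_nat := Pabs; rewrite -dvdn2 => k_even.
have /dvdzP[j ->] : (2 %| k)%Z by [].
by exists j; rewrite mulrC.
Qed.

(** Half of [z] has trace [k] and norm [j], both integers. *)
Lemma quad_int_half z k j : z \in S -> z + z^* = (2 * k)%:~R ->
  z * z^* = (4 * j)%:~R -> z / 2%:R \in S.
Proof.
move=> Sz trE normE.
have two_neq0 : 2%:R != 0 :> algC by rewrite pnatr_eq0.
apply: quad_intE.
  by rewrite quad_field_div ?quad_int_field // rpred_nat.
apply: (@Aint_quadratic _ (z^* / 2%:R)).
  by rewrite -mulrDl trE rmorphM mulrC mulKf ?intr_int.
rewrite mulrACA normE rmorphM /= -[4%:~R]/(4%:R) (natrM _ 2 2) -invfM mulrC.
by rewrite mulKf ?mulf_neq0 ?intr_int.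
Qed.

Lemma exists_half_generator : prime p -> (p = 7 %[mod 8])%N ->
  exists2 t : quad_ring p, mem_P t & quad_val t + (quad_val t)^* = 1.
Proof.
move=> p_prime p_mod8.
pose t : algC := (1 + w) / 2%:R.
have two_neq0 : 2%:R != 0 :> algC by rewrite pnatr_eq0.
have tcE : t^* = (1 - w) / 2%:R.
  have conjM x y : (x * y)^* = x^* * y^* :> algC := rmorphM _ x y.
  have wcE : w^* = - w := conj_quad_root p.
  have conjD x y : (x + y)^* = x^* + y^* :> algC := rmorphD _ x y.
  rewrite conjM conjD conjC1 wcE; congr (_ * _).
  by rewrite fmorphV; congr (_^-1); apply: rmorph_nat.
have trE : t + t^* = 1 by rewrite tcE /t; field.
(* As [p] is 7 modulo 8, this is [(p + 1) / 8], and the norm [(1 + p) / 4] of [t] is [2 * c], which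
   lies in [P]. Primality then puts [t] or its conjugate in [P]. *)
pose c := (p %/ 8).+1.
have normE : t * t^* = (2 * c)%:R.
  have pE : p%:R = 8%:R * c%:R - 1 :> algC.
    have pcE : (p + 1 = 8 * c)%N by rewrite /c; lia.
    by rewrite -natrM -pcE natrD addrK.
  have Dw : w ^+ 2 = 1 - 8%:R * c%:R by rewrite /w sqr_quad_root pE opprB.
  rewrite tcE /t natrM.
  have -> : (1 + w) / 2%:R * ((1 - w) / 2%:R) = (1 - w ^+ 2) / 4%:R by field.
  by rewrite Dw; field.
have Kt : t \in quad_field p.
  apply/quad_fieldP; exists 2%:R^-1, 2%:R^-1.
  by rewrite fmorphV rmorph_nat /t -/w mulrDl mul1r mulrC.
have St : t \in S.
  apply: quad_intE => //; apply: (@Aint_quadratic _ t^*).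
    by rewrite trE.
  by rewrite normE rpred_nat.
pose r := QuadRing St.
have: mem_P (r * quad_conj r).
  have -> : r * quad_conj r = (c * 2)%:R.
    by apply: val_inj; rewrite [RHS]quad_val_nat mulnC -normE.
  by rewrite natrM /mem_P idealMr.
rewrite /mem_P prime_idealrM => /orP[Pr | Pr]; first by exists r.
by exists (quad_conj r); rewrite //= conjCK addrC.
Qed.

Section HalfGenerator.
Variable t : quad_ring p.
Hypothesis Pt : mem_P t.
Hypothesis t_trace : quad_val t + (quad_val t)^* = 1.

(** This reflects that the product of [P] and its conjugate lies in the ideal of 2. The trace of [u]
    is an integer in [P], hence even; its norm is the product of the norms of [a] and [t], both even
    for the same reason. *)
Lemma prime_mul_conj_half a :
  mem_P a -> quad_val a * (quad_val t)^* / 2%:R \in S.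
Proof.
move=> Pa; pose u := a * quad_conj t.
have uE : quad_val u = quad_val a * (quad_val t)^* by [].
have conjM x y : (x * y)^* = x^* * y^* :> algC := rmorphM _ x y.
have ucE : (quad_val u)^* = (quad_val a)^* * quad_val t.
  by rewrite uE conjM conjCK.
have /intrP[k kE] := quad_trace_int (quad_valP u).
have [j jE] : exists j : int, k = 2 * j.
  apply: mem_prime_int; have -> : k%:~R = quad_conj t * a + quad_conj a * t.
    by apply: val_inj; rewrite /= quad_val_int -kE ucE uE [_ * quad_val a]mulrC.
  by rewrite /mem_P rpredD ?idealMr.
have norm_even b : mem_P b ->
    exists j : int, quad_val b * (quad_val b)^* = (2 * j)%:~R.
  move=> Pb; have /intrP[m mE] := quad_norm_int (quad_valP b).
  suff [i iE] : exists i : int, m = 2 * i by exists i; rewrite mE iE.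
  apply: mem_prime_int; have -> : m%:~R = quad_conj b * b.
    by apply: val_inj; rewrite /= quad_val_int -mE mulrC.
  by rewrite /mem_P idealMr.
have [i iE] := norm_even a Pa; have [l lE] := norm_even t Pt.
rewrite -uE; apply: (@quad_int_half _ j (i * l)); first exact: quad_valP.
  by rewrite kE jE.
rewrite ucE uE (_ : _ * _ =
  (quad_val a * (quad_val a)^*) * (quad_val t * (quad_val t)^*)).
  by rewrite iE lE -rmorphM /=; congr (_%:~R); ring.
ring.
Qed.

End HalfGenerator.
End PrimeAboveTwo.

(** * Powers of the prime above 2 and their generators *)

Section PowersAboveTwo.
Variables (p : nat) (P : prime_idealr (quad_ring p)).
Hypothesis P_above_2 : 2%:R \in (P : pred (quad_ring p)).
Variable t : quad_ring p.
Hypothesis Pt : t \in (P : pred (quad_ring p)).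
Hypothesis t_trace : quad_val t + (quad_val t)^* = 1.
Let w : algC := sqrtC (- p%:R).
Let S := quad_int p.
Let T := quad_val t.
Let two_neq0 : 2%:R != 0 :> algC. Proof. by rewrite pnatr_eq0. Qed.
Let twoX_neq0 k : 2%:R ^+ k != 0 :> algC. Proof. exact: expf_neq0. Qed.
Let conjM (x y : algC) : (x * y)^* = x^* * y^*. Proof. exact: rmorphM. Qed.
Let conjX (x : algC) k : (x ^+ k)^* = x^* ^+ k. Proof. exact: rmorphXn. Qed.
Let conjV (x : algC) : (x^-1)^* = (x^*)^-1. Proof. exact: fmorphV. Qed.
Let conj2 : 2%:R^* = 2%:R :> algC. Proof. exact: conjC_nat. Qed.
Let valS (r : quad_ring p) : quad_val r \in S. Proof. exact: quad_valP. Qed.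
Let valM (r s : quad_ring p) : quad_val (r * s) = quad_val r * quad_val s.
Proof. by []. Qed.
Let valX (r : quad_ring p) k : quad_val (r ^+ k) = quad_val r ^+ k.
Proof. exact: (rmorphXn (\val : quad_ring p -> algC)). Qed.

Let val_sum m (F : 'I_m -> quad_ring p) :
  quad_val (\sum_i F i) = \sum_i quad_val (F i).
Proof. exact: (raddf_sum (\val : quad_ring p -> algC)). Qed.
Let val_prod m (F : 'I_m -> quad_ring p) :
  quad_val (\prod_i F i) = \prod_i quad_val (F i).
Proof. exact: (rmorph_prod (\val : quad_ring p -> algC)). Qed.

Lemma bezout_half_exp k : exists u v,
  [/\ u \in S, v \in S & u * T ^+ k + v * T^* ^+ k = 1].
Proof.
have [|u [v uvE]] := @bezout_exp _ t (quad_conj t) k; first by apply: val_inj; apply: t_trace.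
exists (quad_val u), (quad_val v); split; try exact: valS.
rewrite -(valX t) -(valX (quad_conj t)); have := congr1 (@quad_val p) uvE; exact.
Qed.

(** Forward, each of the [k] factors from [P] absorbs one [T^* / 2]. Backward, multiplying [r] by
    the Bezout relation between [T ^+ k] and [T^* ^+ k] writes it as a combination of [t ^+ k] and
    [2 ^+ k]. *)
Lemma mem_ideal_exp k (r : quad_ring p) :
  ideal_exp P k r <-> quad_val r * T^* ^+ k / 2%:R ^+ k \in S.
Proof.
split=> [[m [c [a [Pa ->]]]]|Sr].
  rewrite val_sum !mulr_suml rpred_sum // => i _.
  rewrite valM -!mulrA rpredM ?valS //.
  rewrite val_prod -exprVn mulrA.
  have prod_const (x : algC) : x ^+ k = \prod_(j < k) x by rewrite prodr_const card_ord.
  rewrite !prod_const -!big_split /= rpred_prod // => j _.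
  by have := prime_mul_conj_half P_above_2 Pt (Pa i j).
have [u [v [Su Sv uvE]]] := bezout_half_exp k.
have [s sE] : exists s : quad_ring p, quad_val s = quad_val r * T^* ^+ k / 2%:R ^+ k.
  by exists (QuadRing Sr).
have -> : r = (r * QuadRing Su) * t ^+ k + (s * QuadRing Sv) * 2%:R ^+ k.
  apply: val_inj; transitivity (quad_val r * (u * T ^+ k + v * T^* ^+ k)).
    by rewrite uvE mulr1.
  have clear_denom (x a b d : algC) : d != 0 ->
    x * (u * a + v * b) = (x * u) * a + (x * b / d * v) * d by move=> ?; field.
  by rewrite (clear_denom _ _ _ _ (twoX_neq0 k)) -(valX t) -sE -(quad_val_nat p 2) -valX.
exact: ideal_exp_lincomb.
Qed.

(** Division takes place in [algC], so that divisibility by [x] is an integrality condition like the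
    one in [mem_ideal_exp]. *)
Definition ideal_exp_generator k (x : quad_ring p) : Prop :=
  x != 0 /\ forall r, ideal_exp P k r <-> quad_val r / quad_val x \in S.

Lemma quad_val_eq0 (x : quad_ring p) : (quad_val x == 0) = (x == 0).
Proof. exact: (inj_eq val_inj x 0). Qed.

Lemma principal_ideal_exp k :
  same_ideal_class (ideal_exp P k) (fun=> True) <-> exists x, ideal_exp_generator k x.
Proof.
have divE (x r : quad_ring p) : x != 0 -> 
  quad_val r / quad_val x \in S <-> exists y, r = x * y.
  rewrite -quad_val_eq0 => x_neq0; split=> [Srx|[y ->]].
    by exists (QuadRing Srx); apply: val_inj; rewrite /= mulrC divfK.
  by rewrite valM mulrC mulKf.
have mulI (a x y : quad_ring p) : a != 0 -> a * x = a * y -> x = y.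
  rewrite -quad_val_eq0 => a_neq0 /(congr1 (@quad_val p)); rewrite !valM.
  by move/(mulfI a_neq0)/val_inj.
split=> [[a [b [a0 b0 abE]]]|[x [x0 xE]]].
  (* The generator is the quotient of [b] by [a], which exists because [b * 1] must be [a] times an
     element of the ideal. *)
  have [|x Px bE] := (abE b).2; first by exists 1; rewrite ?mulr1.
  have x0 : x != 0 by apply: contraNneq b0 => x0; rewrite bE x0 mulr0.
  exists x; split=> // r; rewrite divE //; split=> [Pr | [y ->]].
    have [|y _ /eqP] := (abE (a * r)).1; first by exists r.
    by rewrite bE -mulrA => /eqP/mulI-> //; exists y.
  have [|z Pz] := (abE (b * y)).2; first by exists y.
  by rewrite bE -mulrA => /mulI-> //.
exists 1, x; split=> // [|z]; first exact: oner_neq0.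
split=> [[r /xE Pr ->]|[y _ ->]].
  by have /divE[] := Pr => // y ->; exists y; rewrite // mul1r.
by exists (x * y); rewrite ?mul1r //; apply/xE/divE => //; exists y.
Qed.

Lemma half_exp_div_generator k x : ideal_exp_generator k x ->
  T ^+ k / quad_val x \in S /\ 2%:R ^+ k / quad_val x \in S.
Proof.
move=> [x0 xE]; split.
  rewrite -(valX t); apply/xE; have := ideal_exp_lincomb k 1 0 Pt Pt.
  by rewrite mul1r mul0r addr0.
rewrite -(quad_val_nat p 2) -valX; apply/xE.
have := ideal_exp_lincomb k 1 0 P_above_2 P_above_2.
by rewrite mul1r mul0r addr0.
Qed.

Lemma generator_mul_conj_half k x : ideal_exp_generator k x ->
  quad_val x * T^* ^+ k / 2%:R ^+ k \in S.
Proof.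
move=> [x0 xE]; apply/mem_ideal_exp/xE.
by rewrite divff ?rpred1 // quad_val_eq0.
Qed.

(** The ratio [r] of the two sides and its inverse are both integral, as the Bezout relation shows.
    Being positive and rational, they are natural numbers with product 1. *)
Lemma generator_norm k x : ideal_exp_generator k x ->
  quad_val x * (quad_val x)^* = 2%:R ^+ k.
Proof.
move=> xgen; set z := quad_val x.
have z0 : z != 0 by rewrite quad_val_eq0; case: xgen.
have zc0 : z^* != 0 by rewrite conjC_eq0.
have [u [v [Su Sv uvE]]] := bezout_half_exp k.
have [tz_S dz_S] := half_exp_div_generator xgen.
have ztS := generator_mul_conj_half xgen.
have zS : z \in S by apply: valS.
have SJ y : y \in S -> y^* \in S := @conj_quad_int p y.
have J2 : (2%:R ^+ k)^* = 2%:R ^+ k :> algC by rewrite conjX conj2.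
pose r := z * z^* / 2%:R ^+ k.
have Sr : r \in S.
  have -> : r = v * (z^* * (z * T^* ^+ k / 2%:R ^+ k))
              + u * (z * (z * T^* ^+ k / 2%:R ^+ k)^*).
    rewrite !conjM conjV J2 conjX conjCK -[LHS]mulr1 -[X in _ * X = _]uvE /r.
    by field; apply: twoX_neq0.
  by apply: rpredD; apply: rpredM => //; apply: rpredM => //; apply: SJ.
have SrV : r^-1 \in S.
  have -> : r^-1 = u * ((T ^+ k / z) * (2%:R ^+ k / z)^*)
              + v * ((2%:R ^+ k / z) * (T ^+ k / z)^*).
    rewrite !conjM !conjV J2 conjX -[LHS]mulr1 -[X in _ * X = _]uvE /r.
    by field; rewrite z0 zc0 twoX_neq0.
  by apply: rpredD; apply: rpredM => //; apply: rpredM => //; apply: SJ.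
have Qr : r \in Crat.
  apply: rpred_div; last by rewrite rpredX ?rpred_nat.
  exact: quad_norm_Crat (quad_int_field zS).
have r_gt0 : 0 < r.
  by rewrite divr_gt0 ?exprn_gt0 ?ltr0n // -normCK exprn_gt0 // normr_gt0.
have /natrP[a aE] : r \in Num.nat.
  by rewrite natrEint ltW // andbT Cint_rat_Aint // (@quad_int_Aint p).
have /natrP[b bE] : r^-1 \in Num.nat.
  by rewrite natrEint invr_ge0 ltW // andbT Cint_rat_Aint ?rpredV // (@quad_int_Aint p).
have ab1 : (a * b = 1)%N.
  apply/eqP; rewrite -(eqr_nat algC) natrM -aE -bE divff //.
  by rewrite gt_eqF.
have a1 : a = 1%N by have := muln_eq1 a b; rewrite ab1 eqxx => /esym/andP[/eqP].
have : r = 1 by rewrite aE a1.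
by move/divr1_eq.
Qed.

(** An even trace would put both [x] and its conjugate in [P], making [x / 2] integral. Then 2
    divides [T ^+ k] and its conjugate, hence 1 by Bezout. *)
Lemma generator_trace_odd k x (X : int) : (0 < k)%N -> ideal_exp_generator k x ->
  quad_val x + (quad_val x)^* = X%:~R -> odd `|X|.
Proof.
move=> k_gt0 xgen XE; apply/negPn/negP; rewrite -dvdn2 => X_even.
have {X_even} /dvdzP[j jE] : (2 %| X)%Z by [].
have Px : x \in (P : pred (quad_ring p)).
  have [m [c [a [Pa ->]]]] : ideal_exp P k x.
    by have [x0 xE] := xgen; apply/xE; rewrite divff ?rpred1 // quad_val_eq0.
  rewrite rpred_sum // => i _; rewrite idealMr //.
  by case: k k_gt0 a Pa {xgen} => // k _ a Pa; rewrite big_ord_recl mulrC idealMr.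
have Pxc : quad_conj x \in (P : pred (quad_ring p)).
  have -> : quad_conj x = j%:~R * 2%:R - x.
    apply: val_inj; transitivity (X%:~R - quad_val x); first by rewrite -XE addrC addKr.
    have valZ : quad_val (j%:~R * 2%:R : quad_ring p) = j%:~R * 2%:R.
      by rewrite valM quad_val_int quad_val_nat.
    by rewrite jE intrM -valZ.
  by rewrite rpredB // idealMr.
have Sx2 : quad_val x / 2%:R \in S.
  have S1 := prime_mul_conj_half P_above_2 Pt Px.
  have /conj_quad_int S2 := prime_mul_conj_half P_above_2 Pt Pxc.
  have -> : quad_val x / 2%:R =
    quad_val x * T^* / 2%:R + (quad_val (quad_conj x) * T^* / 2%:R)^*.
    by rewrite !conjM !conjCK conjV conj2 -mulrDl -mulrDr [T^* + T]addrC t_trace mulr1.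
  by rewrite rpredD.
have [u [v [Su Sv uvE]]] := bezout_half_exp k.
have [tx_S _] := half_exp_div_generator xgen.
have ST2 : T ^+ k / 2%:R \in S.
  have x0 : quad_val x != 0 by rewrite quad_val_eq0; case: xgen.
  have -> : T ^+ k / 2%:R = (T ^+ k / quad_val x) * (quad_val x / 2%:R).
    by rewrite mulrA divfK.
  exact: rpredM.
have S2V : 2%:R^-1 \in S.
  have -> : 2%:R^-1 = u * (T ^+ k / 2%:R) + v * (T ^+ k / 2%:R)^*.
    by rewrite conjM conjX conjV conj2 !mulrA -mulrDl uvE mul1r.
  by apply: rpredD; apply: rpredM => //; apply: conj_quad_int.
have /intrP[i iE] : 2%:R^-1 \in (Num.int : {pred algC}).
  by rewrite Cint_rat_Aint ?rpredV ?rpred_nat ?(@quad_int_Aint p).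
have : 1 = (2 * i)%:~R :> algC by rewrite intrM -iE divff.
by move/(@intr_inj algC 1); lia.
Qed.

Lemma quad_int_sqrt z : z \in quad_field p -> z ^+ 2 \in S -> z \in S.
Proof. by move=> Kz /quad_int_Aint/Aint_sqr Az; apply: quad_intE. Qed.

(** Both inclusions reduce to an integrality statement whose square is the known one for [x], and
    the ring is integrally closed. *)
Lemma generator_sqrt m x y : ideal_exp_generator m.*2 x ->
  x = y ^+ 2 \/ x = - y ^+ 2 -> ideal_exp_generator m y.
Proof.
move=> xgen xy; have [x0 xE] := xgen.
have y0 : y != 0.
  by apply: contraNneq x0 => y0; case: xy => ->; rewrite y0 expr0n ?oppr0.
have Ky (r : quad_ring p) : quad_val r \in quad_field p := quad_int_field (valS r).
have xyE (z : algC) : (z * quad_val x \in S) = (z * quad_val y ^+ 2 \in S)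
    /\ (z / quad_val x \in S) = (z / quad_val y ^+ 2 \in S).
  rewrite -valX; case: xy => ->; first by [].
  have -> : quad_val (- y ^+ 2) = - quad_val (y ^+ 2) by [].
  by rewrite invrN !mulrN !rpredN.
split=> // r; split=> [/mem_ideal_exp Pr|Sry].
  have Sr2 : quad_val (r ^+ 2) / quad_val x \in S.
    apply/xE/mem_ideal_exp; rewrite valX -muln2 !exprM -!exprVn -!exprMn.
    by rewrite exprVn rpredX.
  apply: quad_int_sqrt; first by rewrite quad_field_div.
  by rewrite exprMn exprVn -(xyE _).2 -valX.
apply/mem_ideal_exp; have y0' : quad_val y != 0 by rewrite quad_val_eq0.
have -> : quad_val r * T^* ^+ m / 2%:R ^+ m =
    (quad_val r / quad_val y) * (quad_val y * (T^* ^+ m / 2%:R ^+ m)).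
  by rewrite mulrA divfK ?mulrA.
apply: rpredM => //.
have KT : T^* ^+ m / 2%:R ^+ m \in quad_field p.
  have KTc : T^* ^+ m \in quad_field p.
    by rewrite -(valX (quad_conj t)); apply: Ky.
  by apply: quad_field_div => //; rewrite -(quad_val_nat p 2) -valX; apply: Ky.
apply: quad_int_sqrt; first by apply: quad_fieldM => //; apply: Ky.
rewrite exprMn mulrC -(xyE _).1 mulrC exprMn exprVn -!exprM muln2 mulrA.
exact: generator_mul_conj_half.
Qed.

Lemma generator_coords k x : prime p -> ideal_exp_generator k x ->
  exists X Y : int, [/\ 2%:R * quad_val x = X%:~R + Y%:~R * w,
    quad_val x + (quad_val x)^* = X%:~R & X ^+ 2 + p%:Z * Y ^+ 2 = 2 ^+ k.+2].
Proof.
move=> p_prime xgen; have [X [Y XYE]] := quad_int_coords p_prime (valS x).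
have wcE : w^* = - w := conj_quad_root p.
have conjD (a b : algC) : (a + b)^* = a^* + b^* by apply: rmorphD.
have conjZ (a : int) : (a%:~R)^* = a%:~R :> algC by apply: rmorph_int.
have XYcE : 2%:R * (quad_val x)^* = X%:~R - Y%:~R * w.
  by rewrite -conj2 -conjM XYE conjD conjM !conjZ wcE mulrN.
exists X, Y; split=> //.
  by apply: (mulfI two_neq0); rewrite mulrDr XYE XYcE addrACA subrr addr0 mulr_natl mulr2n.
apply: (@intr_inj algC).
have -> : (2 ^+ k.+2)%:~R = (2%:R * quad_val x) * (2%:R * (quad_val x)^*).
  rewrite mulrACA (generator_norm xgen) -natrM.
  by rewrite rmorphXn /= !exprS mulrA -natrM.
rewrite XYE XYcE [RHS]mulrC -subr_sqr [(_ * w) ^+ 2]exprMn /w sqr_quad_root mulrN opprK.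
by rewrite intrD intrM !rmorphXn /= mulrC.
Qed.

Lemma generator_even_sqrt m x : prime p -> (0 < m)%N ->
  ideal_exp_generator m.*2 x -> exists y, ideal_exp_generator m y.
Proof.
move=> p_prime m_gt0 xgen.
have [X [Y [XYE trE normE]]] := generator_coords p_prime xgen.
have X_odd : odd `|X| by apply: generator_trace_odd xgen trE; rewrite double_gt0.
have absz_sqr (Z : int) : `|Z|%N%:Z ^+ 2 = Z ^+ 2 by rewrite abszE real_normK ?num_real.
have normN : (`|X| ^ 2 + p * `|Y| ^ 2 = 2 ^ m.+1.*2)%N.
  apply/eqP; rewrite -(eqr_nat int) natrD natrM !natrX !natz !absz_sqr normE.
  by rewrite doubleS.
(* Otherwise the odd square of [X] would be a positive power of two. *)
have Y_gt0 : (0 < `|Y|)%N.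
  rewrite lt0n; apply/eqP => Y0; have := congr1 odd normN.
  by rewrite Y0 muln0 addn0 !oddX X_odd.
have [s [r [rsE stE rs]]] := norm_form_even_power p_prime X_odd Y_gt0 normN.
have rsZ : r%:Z ^+ 2 + p%:Z * s%:Z ^+ 2 = 2 ^+ m.+2.
  by rewrite -!natz -!natrX -natrM -natrD rsE.
(* The sign [e] combines the sign of [X] with the alternative of [norm_form_even_power]. The sign of
   [s'] is then chosen so that [y ^+ 2], with [y] half of [r + s' * w], equals [e] times the
   generator. *)
have [e e1 eE] : exists2 e : int, e = 1 \/ e = -1 &
    r%:Z ^+ 2 - p%:Z * s%:Z ^+ 2 = e * (2 * X).
  have [d d1 dE] : exists2 d : int, d = 1 \/ d = -1 &
      r%:Z ^+ 2 - p%:Z * s%:Z ^+ 2 = d * (2 * `|X|%N%:Z).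
    rewrite -!natz -!natrX -!natrM.
    case: rs => ->; [exists 1; first by left | exists (-1); first by right].
      by rewrite natrD mul1r addrAC subrr add0r.
    by rewrite natrD mulN1r opprD addrA subrr sub0r.
  have [XE | XE] : X = `|X|%N :> int \/ X = - `|X|%N%:Z by lia.
    by exists d; rewrite // [X in RHS]XE.
  by exists (- d); [lia | rewrite dE {2}XE !mulrN mulNr opprK].
have [s' s'2 s'E] : exists2 s' : int, s' ^+ 2 = s%:Z ^+ 2 & r%:Z * s' = e * Y.
  have rsY : r%:Z * s%:Z = `|Y|%N%:Z by rewrite -PoszM mulnC stE.
  have [eY | eY] : e * Y = `|Y|%N :> int \/ e * Y = - `|Y|%N%:Z by case: e1 => ->; lia.
    by exists s; rewrite // eY.
  by exists (- s%:Z); rewrite ?sqrrN // mulrN eY rsY.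
pose y : algC := (r%:R + s'%:~R * w) / 2%:R.
have wcE : w^* = - w := conj_quad_root p.
have ycE : y^* = (r%:R - s'%:~R * w) / 2%:R.
  have conjD (a b : algC) : (a + b)^* = a^* + b^* by apply: rmorphD.
  have conjZ (a : int) : (a%:~R)^* = a%:~R :> algC by apply: rmorph_int.
  by rewrite conjM conjD conjM conjV conj2 wcE conjZ conjC_nat mulrN.
have Ky : y \in quad_field p.
  apply/quad_fieldP; exists (r%:R / 2%:R), (s'%:~R / 2%:R).
  by rewrite !fmorph_div !rmorph_nat rmorph_int -/w /y; field.
have w2 : w ^+ 2 = - p%:R := sqr_quad_root p.
have Sy : y \in S.
  apply: quad_intE => //; apply: (@Aint_quadratic _ y^*).
    have -> : y + y^* = r%:R by rewrite ycE /y; field.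
    by rewrite rpred_nat.
  have -> : y * y^* = 2%:R ^+ m; last by rewrite rpredX ?rpred_nat.
  have -> : y * y^* = (r%:R ^+ 2 - s'%:~R ^+ 2 * w ^+ 2) / 4%:R.
    by rewrite ycE /y; field.
  have : (r%:Z ^+ 2 + p%:Z * s' ^+ 2)%:~R = (2 ^+ m.+2)%:~R :> algC by rewrite s'2 rsZ.
  rewrite intrD intrM !rmorphXn /= w2 mulrN opprK [_ * p%:R]mulrC => ->.
  by rewrite !exprS; field.
exists (QuadRing Sy); apply: (generator_sqrt xgen).
have y2E : y ^+ 2 = e%:~R * quad_val x.
  have -> : y ^+ 2 =
      (r%:R ^+ 2 + s'%:~R ^+ 2 * w ^+ 2 + 2%:R * (r%:R * s'%:~R) * w) / 4%:R.
    by rewrite /y; field.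
  have : (r%:Z ^+ 2 - p%:Z * s' ^+ 2)%:~R = (e * (2 * X))%:~R :> algC by rewrite s'2 eE.
  rewrite w2 intrB intrM !rmorphXn /= mulrN [_ * p%:R]mulrC => ->.
  have /(congr1 (fun k : int => k%:~R : algC)) := s'E; rewrite /= !intrM => ->.
  have -> : quad_val x = (X%:~R + Y%:~R * w) / 2%:R by rewrite -XYE mulrC mulKf.
  by field.
case: e1 y2E => -> y2E; [left | right]; apply: val_inj; move: y2E.
  by rewrite /= mul1r => <-.
by rewrite /= mulN1r => /eqP; rewrite eq_sym eqr_oppLR => /eqP.
Qed.

(** The norm equation has right-hand side 8, so [p > 8] forces [Y = 0], and 8 is not a square. *)
Lemma no_generator_one x : prime p -> (8 < p)%N -> ~ ideal_exp_generator 1 x.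
Proof.
move=> p_prime p_gt8 xgen.
have [X [Y [_ trE normE]]] := generator_coords p_prime xgen.
have X_odd : odd `|X| by apply: generator_trace_odd xgen trE.
have Y0 : Y = 0 by apply/eqP; apply: contraTT p_gt8; nia.
by move: normE; rewrite Y0; nia.
Qed.

End PowersAboveTwo.

(** * The parity of the class order, and the conclusion *)

Lemma class_order_above_two p (P : prime_idealr (quad_ring p)) n :
  prime p -> (8 < p)%N -> (p = 7 %[mod 8])%N ->
  2%:R \in (P : pred (quad_ring p)) ->
  is_class_order (P : pred (quad_ring p)) n -> odd n /\ (1 < n)%N.
Proof.
move=> p_prime p_gt8 p_mod8 P_above_2 [n_gt0 triv_n n_min].
have [t Pt t_trace] := exists_half_generator P_above_2 p_prime p_mod8.
have principal k := principal_ideal_exp P k.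
have odd_n : odd n.
  apply/negPn/negP => even_n; have nE : n./2.*2 = n by rewrite even_halfK.
  have m_gt0 : (0 < n./2)%N by lia.
  have [x xgen] := (principal n).1 triv_n; rewrite -nE in xgen.
  have /principal/(n_min _ m_gt0) :=
    generator_even_sqrt P_above_2 Pt t_trace p_prime m_gt0 xgen.
  lia.
split=> //; rewrite ltn_neqAle n_gt0 andbT; apply/eqP => n1.
have [x xgen] := (principal n).1 triv_n; rewrite -n1 in xgen.
exact: (no_generator_one P_above_2 Pt t_trace p_prime p_gt8 xgen).
Qed.

Theorem theorem31 (p : nat) (p_prime : prime p)
    (p_mod : (p = 71 %[mod 120] \/ p = 119 %[mod 120])%N)
    (P : prime_idealr (quad_ring p)) (P_above_2 : 2%:R \in (P : pred (quad_ring p)))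
    (ord : nat) (ordP : is_class_order (P : pred (quad_ring p)) ord) :
  (diameter (@folded_graph ord))%:R = (ord%:R + 1) / 2%:R :> rat.
Proof.
have p_gt8 : (8 < p)%N by case: p_mod; lia.
(* 8 divides 120, and both 71 and 119 are 7 modulo 8. *)
have p_mod8 : (p = 7 %[mod 8])%N by case: p_mod; lia.
have [odd_n n_gt1] := class_order_above_two p_prime p_gt8 p_mod8 P_above_2 ordP.
have [h nE] : exists h, (ord = 2 * h + 3)%N by exists (ord - 3)./2; lia.
by rewrite (diameter_folded_graph nE) nE (natrD _ (2 * h)) natrM natrD; field.
Qed.
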